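(* Let $(X,\mathcal{B},\mu)$ be a standard probability space and let $\phi:\mathbb{R}\to\mathbb{R}$ be a measurable function satisfying $\lim_{x\to\infty}\phi(x)=\infty$. Let $b_i>0$ ($i\in\mathbb{N}$) be real numbers such that $\lim_{i\to\infty}b_i=\infty$; for every real $\alpha>0$, $\lim_{i\to\infty} b_i/b_{i+1}^{\alpha}=0$; and for every $i\in\mathbb{N}$ and every $y\ge b_i/4$, $\phi(y)/2^i\ge i$. Let $A\subset X$ be measurable with $\mu(A)=1/2$, and let $B_i\subset X\setminus A$ ($i\in\mathbb{N}$) be pairwise disjoint measurable sets with $\mu(B_i)=\dfrac{1}{b_i 2^{i+1}}$. Let $$f=I_A-\sum_{i=1}^\infty b_i I_{B_i}$$ (so that $f\in L^1$ has mean zero). If $T:X\to X$ is an ergodic invertible measure preserving transformation and $g:X\to\mathbb{R}$ is a measurable function satisfying $f(x)=g(Tx)-g(x)$ for almost every $x\in X$, then $$\int_X \phi(|g|)\,d\mu=\infty.$$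
   Context: A standard probability space here means one isomorphic to $[0,1]$ with Lebesgue measure. $I_E$ denotes the indicator function of a set $E$. $\mathbb{N}=\{1,2,3,\dots\}$. *)

(* Defs.v *)
From HB Require Import structures.
From mathcomp Require Import all_boot all_order all_algebra.
From mathcomp Require Import all_classical all_reals all_analysis.

Set Implicit Arguments.
Unset Strict Implicit.
Unset Printing Implicit Defensive.

Import Order.TTheory GRing.Theory Num.Theory.
Import numFieldNormedType.Exports.

Local Open Scope classical_set_scope.
Local Open Scope ring_scope.

(* (T1, mu) and (D, nu restricted to D) are isomorphic modulo null sets: [h]
   is a bimeasurable measure-preserving bijection between subsets of full
   measure. *)
Definition mod0_isomorphic (R : realType) (d1 d2 : measure_display)
    (T1 : measurableType d1) (mu : {measure set T1 -> \bar R})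
    (T2 : measurableType d2) (nu : {measure set T2 -> \bar R}) (D : set T2) :
    Prop :=
  exists (X1 : set T1) (X2 : set T2) (h : T1 -> T2),
    [/\ measurable X1 /\ mu (~` X1) = 0%E,
        [/\ measurable X2, X2 `<=` D & nu (D `\` X2) = 0%E],
        set_bij X1 X2 h,
        measurable_fun X1 h &
        forall E, E `<=` X1 -> measurable E ->
          measurable (h @` E) /\ nu (h @` E) = mu E].

(* Both usual conventions for "[0, 1] with Lebesgue measure" are admitted:
   the Borel sigma-algebra, or the Lebesgue sigma-algebra. A complete space
   is never isomorphic to the former, nor a standard Borel one to the latter. *)
Definition standard_probability_space (R : realType) (d : measure_display)
    (T : measurableType d) (P : probability T R) : Prop :=
  mod0_isomorphic P (@lebesgue_measure R) `[0, 1] \/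
  mod0_isomorphic P (@completed_lebesgue_measure R) `[0, 1].

Definition measure_preserving (R : realType) (d : measure_display)
    (T : measurableType d) (P : probability T R) (S : T -> T) : Prop :=
  measurable_fun setT S /\
  forall E, measurable E -> P (S @^-1` E) = P E.

Definition invertible_measure_preserving (R : realType) (d : measure_display)
    (T : measurableType d) (P : probability T R) (S : T -> T) : Prop :=
  measure_preserving P S /\
  exists S' : T -> T,
    [/\ cancel S S', cancel S' S & measure_preserving P S'].

Definition ergodic (R : realType) (d : measure_display)
    (T : measurableType d) (P : probability T R) (S : T -> T) : Prop :=
  forall E, measurable E -> S @^-1` E = E -> P E = 0%E \/ P E = 1%E.

(* "The integral of u is +oo" for a u that may take both signs. If u^- is not
   integrable then the integral of u is the undefined form oo - oo, to which
   the library gives the value -oo; in that case only the first clause, which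
   says that u^+ is not integrable, has content. *)
Definition integral_is_pinfty (R : realType) (d : measure_display)
    (T : measurableType d) (mu : {measure set T -> \bar R}) (u : T -> R) :
    Prop :=
  (\int[mu]_x (EFin \o u)^\+ x = +oo)%E /\
  ((\int[mu]_x (EFin \o u)^\- x < +oo)%E ->
   (\int[mu]_x (u x)%:E = +oo)%E).

(* Main.v *)
(* Let c = b_i / 4 and let psi collapse [-c, c] to a point, so that psi is
   nondecreasing and 1-Lipschitz; clipping makes psi o g integrable, hence
   psi o g o T - psi o g has integral 0.  Since f <= 1, this difference is at
   most 1_{g < -c} + 1_{g o T > c}.  On B_i, g drops by 4c, of which at most 2c
   is lost in the dead zone, so the difference is at most -2c there (up to
   clipping).  Hence mu(|g| > c) >= 2c mu(B_i) = 2^-i / 4, and as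
   phi >= i 2^i on [c, +oo[, the integral of phi(|g|)^+ is at least i / 4 for
   every i. *)
Require Import Defs.
From HB Require Import structures.
From mathcomp Require Import all_boot all_order all_algebra.
From mathcomp Require Import all_classical all_reals all_analysis.
From mathcomp Require Import measurable_realfun ring lra.

Set Implicit Arguments.
Unset Strict Implicit.
Unset Printing Implicit Defensive.

Import Order.TTheory GRing.Theory Num.Theory.
Import numFieldNormedType.Exports.

Local Open Scope classical_set_scope.
Local Open Scope ring_scope.

(* Clipped to [-M, M], then shifted by M to be nonnegative. *)
Definition clipped_dead_zone (R : realType) (c M t : R) : R :=
  Num.max 0 (Num.min (2 * M) (Num.max (t - c) 0 + Num.min (t + c) 0 + M)).

Lemma clipped_dead_zone_ge0 (R : realType) (c M t : R) :
  0 <= clipped_dead_zone c M t.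
Proof. by rewrite le_max lexx. Qed.

Lemma clipped_dead_zone_le (R : realType) (c M t : R) :
  0 <= M -> clipped_dead_zone c M t <= 2 * M.
Proof. by move=> M0; rewrite ge_max ge_min lexx mulr_ge0. Qed.

(** If [- c <= t] and [s <= c], the dead zone sends [s] to a value at most 0 and [t] to one at least
    0, so nothing rises. Otherwise at least one indicator is 1, which pays for a rise of at most 1,
    since the dead zone is nondecreasing and 1-Lipschitz. *)
Lemma clipped_dead_zone_rise (R : realType) (c M s t : R) :
  0 < c -> 0 <= M -> s <= t + 1 ->
  clipped_dead_zone c M s <=
  clipped_dead_zone c M t + (t < - c)%R%:R + (c < s)%R%:R.
Proof.
move=> c0 M0 st; rewrite /clipped_dead_zone -[leRHS]addrA.
set k := _%:R + _%:R; have k0 : 0 <= k by rewrite addr_ge0.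
have : Num.max (s - c) 0 + Num.min (s + c) 0 <=
       Num.max (t - c) 0 + Num.min (t + c) 0 + k.
  rewrite /k.
  case: (ltP t (- c)) => ?; case: (ltP c s) => ?;
  case: (leP (s - c) 0) => ?; case: (leP (s + c) 0) => ?; try lra;
  case: (leP (t - c) 0) => ?; case: (leP (t + c) 0) => ?; rewrite /=; lra.
(* Clipping is nondecreasing and 1-Lipschitz, so it preserves [x <= y + k] for [k >= 0]. *)
move: (_ + _) (Num.max (t - c) 0 + _) => x y xy.
have M2 : 0 <= 2 * M by lra.
case: (leP (2 * M) (x + M)) => ?; case: (leP (2 * M) (y + M)) => ?;
  rewrite ?(max_r M2) ?maxEle; do ?case: ifPn; rewrite -?ltNge; lra.
Qed.

(** The segment from [t - 4 * c] to [t] meets the dead zone in length at most [2 * c], so at least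
    [2 * c] of the drop survives. The level [n + 4 * c] is high enough that neither endpoint is
    clipped. *)
Lemma clipped_dead_zone_drop (R : realType) (c n t : R) :
  0 < c -> `|t| <= n ->
  clipped_dead_zone c (n + 4 * c) (t - 4 * c) + 2 * c <=
  clipped_dead_zone c (n + 4 * c) t.
Proof.
move=> c0; rewrite ler_norml => /andP[t1 t2]; rewrite /clipped_dead_zone.
set x := Num.max (t - 4 * c - c) 0 + _; set y := Num.max (t - c) 0 + _.
have [] : [/\ x + 2 * c <= y, - (n + 4 * c) <= x & y <= n + 4 * c].
  rewrite /x /y; case: (leP (t - c) 0) => ?; case: (leP (t + c) 0) => ?; try lra;
  case: (leP (t - _ - c) 0) => ?; case: (leP (t - _ + c) 0) => ?; split; lra.
move: x y => x y xy xn yn.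
by rewrite !min_r ?max_r //; lra.
Qed.

Lemma measurable_clipped_dead_zone (R : realType) (c M : R) :
  measurable_fun setT (clipped_dead_zone c M).
Proof.
apply: measurable_maxr => //; apply: measurable_minr => //.
apply: measurable_funD => //; apply: measurable_funD.
- by apply: measurable_maxr => //; apply: measurable_funB.
- by apply: measurable_minr => //; apply: measurable_funD.
Qed.

Lemma measure_preserving_integral (R : realType) (d : measure_display)
    (X : measurableType d) (mu : probability X R) (T : X -> X)
    (u : X -> \bar R) :
  measure_preserving mu T -> measurable_fun setT u ->
  (forall x, 0 <= u x)%E ->
  (\int[mu]_x u (T x) = \int[mu]_x u x)%E.
Proof.
move=> [mT muT] mu_ u0.
have := @ge0_integral_pushforward _ _ _ _ R T mT mu setT u measurableT mu_
  (fun y _ => u0 y).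
rewrite preimage_setT => <-.
by apply: eq_measure_integral => E mE _; rewrite /= /pushforward muT.
Qed.

Lemma drop_mass (R : realType) (d : measure_display)
    (X : measurableType d) (mu : probability X R) (T : X -> X) (g : X -> R)
    (c : R) (B : set X) :
  measure_preserving mu T -> measurable_fun setT g -> 0 < c -> measurable B ->
  {ae mu, forall x, g (T x) <= g x + 1 /\ (B x -> g (T x) = g x - 4 * c)} ->
  ((2 * c)%:E * mu B <= mu [set x | (c < `|g x|)%R])%E.
Proof.
move=> Tmp mg c0 mB gT.
have [mT muT] := Tmp.
have mgi (I : interval R) : measurable (g @^-1` [set` I]).
  by rewrite -[X in measurable X]setTI; exact: mg.
pose L := [set x | g x < - c]; pose U := [set x | c < g x].
have mL : measurable L.
  rewrite (_ : L = g @^-1` `]-oo, - c[); first exact: mgi.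
  by apply/seteqP; split => x; rewrite /L /= in_itv.
have mU : measurable U.
  rewrite (_ : U = g @^-1` `]c, +oo[); first exact: mgi.
  by apply/seteqP; split => x; rewrite /U /= in_itv /= ?andbT.
have -> : [set x | c < `|g x|] = L `|` U.
  by apply/seteqP; split => x /=; rewrite /L /U /= lter_normr ltrNr orbC => /orP.
rewrite measureU //; last first.
  by apply/seteqP; split => x //; rewrite /L /U /= => -[]; lra.
(* As [g] may be unbounded, no single clipping level serves all of [B]. The bound is proved on each
   [K n], with a level depending on [n], and passes to [B] by continuity from below. *)
pose K n := B `&` [set x | `|g x| <= n%:R].
have mK n : measurable (K n).
  apply: measurableI => //.
  rewrite (_ : [set _ | _] = g @^-1` `[- n%:R, n%:R]); first exact: mgi.
  by apply/seteqP; split => x; rewrite /= in_itv /= ler_norml.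
have BK : B = \bigcup_n K n.
  apply/seteqP; split => [x Bx|x [n _ []]//].
  exists (Num.truncn `|g x|).+1 => //; split => //=.
  by rewrite ltW // truncnS_gt.
have cvK : ((2 * c)%:E * mu (K n))%E @[n --> \oo] --> ((2 * c)%:E * mu B)%E.
  apply: cvgeZl => //; rewrite BK; apply: nondecreasing_cvg_mu => //.
    by rewrite -BK.
  move=> n m nm; apply/subsetPset => x [Bx /= gx]; split => //=.
  by rewrite (le_trans gx) // ler_nat.
rewrite -(cvg_lim _ cvK) //.
apply: lime_le; first by apply/cvg_ex; eexists; exact: cvK.
apply: nearW => n.
pose M := n%:R + 4 * c; pose psi := clipped_dead_zone c M.
have M0 : 0 <= M by rewrite addr_ge0 // mulr_ge0 // ltW.
have mpsi : measurable_fun setT (psi \o g).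
  by apply: measurableT_comp => //; exact: measurable_clipped_dead_zone.
have psi0 x : (0 <= (psi (g x))%:E)%E.
  by rewrite lee_fin clipped_dead_zone_ge0.
have mTU : measurable (T @^-1` U).
  by rewrite -[X in measurable X]setTI; exact: mT.
have ipsi_fin : (\int[mu]_x (psi (g x))%:E)%E \is a fin_num.
  rewrite ge0_fin_numE; last exact: integral_ge0.
  apply: (@le_lt_trans _ _ (\int[mu]_x (2 * M)%:E)%E).
    apply: ge0_le_integral => //; first exact/measurable_EFinP.
    by move=> x _; rewrite lee_fin clipped_dead_zone_le.
  by rewrite integral_cst // [X in (_ * X)%E]probability_setT mule1 ltry.
(* The integral of [psi \o g] is finite, so it may be added to both sides; on the left, invariance
   turns it into that of [psi \o g \o T]. *)
rewrite -(leeD2lE _ _ ipsi_fin).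
rewrite -{1}(@measure_preserving_integral _ _ _ _ _ (EFin \o (psi \o g)) Tmp) //;
  last exact/measurable_EFinP.
(* The pointwise bound tests [c < g (T x)], hence the preimage of [U]. *)
have -> : (mu L + mu U = mu L + mu (T @^-1` U))%E by rewrite muT.
have -> : ((2 * c)%:E * mu (K n) = \int[mu]_x ((2 * c) * \1_(K n) x)%:E)%E.
  rewrite (@integralZl_indic _ _ _ mu setT measurableT (fun=> K n)) //.
    by rewrite integral_indic // setIT.
  by move=> h; exfalso; lra.
have indE E : measurable E -> mu E = (\int[mu]_x (\1_E x)%:E)%E.
  by move=> mE; rewrite integral_indic // setIT.
rewrite (indE _ mL) (indE _ mTU).
have mind E : measurable E -> measurable_fun setT (EFin \o (\1_E : X -> R)).
  by move=> mE; apply/measurable_EFinP; exact: measurable_indic.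
have mpsiT : measurable_fun setT (fun x => (psi (g (T x)))%:E).
  by apply/measurable_EFinP; exact: (measurableT_comp mpsi).
have mcK : measurable_fun setT (fun x => (2 * c * \1_(K n) x)%:E).
  by apply/measurable_EFinP; apply: measurable_funM => //; exact: measurable_indic.
have cK0 x : (0 <= (2 * c * \1_(K n) x)%:E)%E.
  by rewrite lee_fin mulr_ge0 // mulr_ge0 // ltW.
have mpsi' : measurable_fun setT (fun x => (psi (g x))%:E) by exact/measurable_EFinP.
have LU0 x : (0 <= (\1_L x)%:E + (\1_(T @^-1` U) x)%:E :> \bar R)%E.
  by rewrite -EFinD lee_fin addr_ge0.
have mLU : measurable_fun setT
    (fun x => ((\1_L x)%:E + (\1_(T @^-1` U) x)%:E)%E : \bar R).
  by apply: emeasurable_funD; exact: mind.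
rewrite -!ge0_integralD //; try exact: mind;
  try by move=> x _; rewrite ?lee_fin; exact: psi0.
apply: ae_ge0_le_integral => //.
- by move=> x _; apply: adde_ge0 => //; exact: psi0.
- exact: emeasurable_funD.
- by move=> x _; apply: adde_ge0 => //; exact: psi0.
- exact: emeasurable_funD.
apply: filterS gT => x [rise drop] _.
rewrite -!EFinD lee_fin !indicE /=.
have [/set_mem [Bx gxn]|_] := boolP (x \in K n).
  rewrite mulr1 drop //; apply: (le_trans (clipped_dead_zone_drop c0 gxn)).
  by rewrite lerDl addr_ge0.
rewrite mulr0 addr0.
have := clipped_dead_zone_rise c0 M0 rise.
rewrite -[_ + _ + _]addrA -/psi => /le_trans; apply.
rewrite lerD2l lerD // ler_nat.
- by case: ltP => // h; rewrite mem_set.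
- by case: ltP => // h; rewrite mem_set.
Qed.

Theorem proposition4p6 (R : realType) (d : measure_display)
    (X : measurableType d) (mu : probability X R)
    (hX : standard_probability_space mu)
    (phi : R -> R) (mphi : measurable_fun setT phi)
    (phi_oo : phi x @[x --> +oo] --> +oo)
    (b : nat -> R)
    (b_gt0 : forall i : nat, (0 < i)%N -> 0 < b i)
    (b_oo : b i @[i --> \oo] --> +oo)
    (b_growth : forall alpha : R, 0 < alpha ->
       b i / (b i.+1 `^ alpha) @[i --> \oo] --> (0 : R))
    (b_phi : forall (i : nat) (y : R), (0 < i)%N -> b i / 4 <= y ->
       i%:R <= phi y / 2 ^+ i)
    (A : set X) (mA : measurable A) (muA : mu A = (1 / 2)%:E)
    (B : nat -> set X)
    (B_sub : forall i : nat, (0 < i)%N -> B i `<=` ~` A)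
    (B_disj : trivIset [set i : nat | (0 < i)%N] B)
    (mB : forall i : nat, (0 < i)%N -> measurable (B i))
    (muB : forall i : nat, (0 < i)%N ->
       mu (B i) = (1 / (b i * 2 ^+ i.+1))%:E)
    (f : X -> R)
    (f_def : forall x : X,
       f x =
         \1_A x - limn (fun n : nat => \sum_(1 <= i < n) b i * \1_(B i) x))
    (T : X -> X) (T_inv : invertible_measure_preserving mu T)
    (T_erg : ergodic mu T)
    (g : X -> R) (mg : measurable_fun setT g)
    (fg : {ae mu, forall x, f x = g (T x) - g x}) :
  integral_is_pinfty mu (fun x => phi `|g x|).
Proof.
have Tmp := T_inv.1.
(* By disjointness at most one term of the series is nonzero at [x], so the partial sums are
   constant once [n > i]. *)
have limB x i : (0 < i)%N -> B i x ->
    limn (fun n : nat => \sum_(1 <= j < n) b j * \1_(B j) x) = b i.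
  move=> i0 Bix; apply: lim_near_cst => //.
  near=> n.
  have ni : (i < n)%N by near: n; exact: nbhs_infty_gt.
  rewrite (bigD1_seq i) ?iota_uniq ?mem_index_iota ?i0 //=.
  rewrite indicE mem_set // mulr1 big_seq_cond big1 ?addr0 // => j.
  rewrite mem_index_iota => /andP[/andP[j0 _] ji].
  rewrite indicE memNset ?mulr0 // => Bjx.
  by move/eqP: ji; apply; apply: B_disj => //; exists x.
have lim0 x : (forall i, (0 < i)%N -> ~ B i x) ->
    limn (fun n : nat => \sum_(1 <= j < n) b j * \1_(B j) x) = 0.
  move=> NB; apply: lim_near_cst => //; apply: nearW => n.
  rewrite big_seq_cond big1 // => j.
  rewrite mem_index_iota andbT => /andP[j0 _].
  by rewrite indicE memNset ?mulr0 //; exact: NB.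
have f_le1 x : f x <= 1.
  rewrite f_def lerBlDr.
  have i1 : \1_A x <= 1 :> R by rewrite indicE lern1 leq_b1.
  apply: (le_trans i1); rewrite lerDl.
  have [[i [i0 Bix]]|NB] := pselect (exists i, (0 < i)%N /\ B i x).
    by rewrite (limB _ i) // ltW // b_gt0.
  by rewrite lim0 // => i i0 Bix; apply: NB; exists i.
have fB i x : (0 < i)%N -> B i x -> f x = - b i.
  move=> i0 Bix; rewrite f_def (limB _ i) // indicE memNset; first by rewrite sub0r.
  exact: (B_sub i i0 x Bix).
set u := fun x => phi `|g x|.
have mu_ : measurable_fun setT u.
  apply: measurableT_comp => //; exact: measurableT_comp.
have mup : measurable_fun setT (EFin \o u)^\+%E.
  by apply: measurable_funepos; exact/measurable_EFinP.
have upoo : (\int[mu]_x (EFin \o u)^\+ x = +oo)%E.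
  apply/eqyP => r r0.
  (* The lower bound obtained below is [i / 4], so [i >= 4 * r] is what is needed. *)
  pose i := (Num.truncn (r * 4)).+1.
  have i0 : (0 < i)%N by [].
  have ri : r * 4 <= i%:R by rewrite ltW // truncnS_gt.
  have bi := b_gt0 i i0.
  have c0 : 0 < b i / 4 by rewrite divr_gt0.
  pose E := [set x | b i / 4 < `|g x|].
  have mE : measurable E.
    have mng : measurable_fun setT (Num.norm \o g) by exact: measurableT_comp.
    rewrite (_ : E = (Num.norm \o g) @^-1` `]b i / 4, +oo[).
      by rewrite -[X in measurable X]setTI; exact: mng.
    by apply/seteqP; split => x; rewrite /E /= in_itv /= ?andbT.
  (* With [c = b i / 4], the drop [4 * c] is exactly the value [b i] of [- f] on [B i]. *)
  have muE : ((2 * (b i / 4))%:E * mu (B i) <= mu E)%E.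
    apply: (@drop_mass _ _ _ _ T) => //; first exact: mB.
    apply: filterS fg => x fx; split=> [|Bx].
      by have := f_le1 x; lra.
    by have := fB _ _ i0 Bx; lra.
  apply: (@le_trans _ _ (\int[mu]_(x in E) (i%:R * 2 ^+ i)%:E)%E).
    rewrite integral_cst //.
    apply: (@le_trans _ _ ((i%:R * 2 ^+ i)%:E * ((2 * (b i / 4))%:E * mu (B i)))%E).
      rewrite muB // -!EFinM lee_fin.
      have p0 : (2 ^+ i : R) != 0 by rewrite expf_neq0.
      have -> : i%:R * 2 ^+ i * (2 * (b i / 4) * (1 / (b i * 2 ^+ i.+1))) =
        i%:R / 4 :> R.
        by rewrite exprS; field; rewrite p0 gt_eqF.
      by lra.
    by rewrite lee_pmul2l // lte_fin mulr_gt0 // ?ltr0n // exprn_gt0.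
  apply: (@le_trans _ _ (\int[mu]_(x in E) (EFin \o u)^\+ x)%E).
    apply: ge0_le_integral => //.
    - exact: measurable_funTS.
    - move=> x Ex; rewrite /= funeposE le_max lee_fin; apply/orP; left.
      rewrite -ler_pdivlMr ?exprn_gt0 //.
      by apply: b_phi => //; exact: ltW.
  exact: ge0_subset_integral.
(* Given that the negative part has finite integral, the difference of the two integrals is not the
   undefined form, so it is [+oo]. *)
split=> // un; rewrite integralE upoo addye // eqe_oppLR.
by rewrite lt_eqF.
Unshelve. all: by end_near.
Qed.
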